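(* Every consistent atomic RCC8 network over $\{\mathbf{EC},\mathbf{DC},\mathbf{PO}\}$ has a convex solution in $\mathbb{R}^3$.
   Context: A region in $\mathbb{R}^n$ ($n\geq 1$) is a nonempty regular closed subset $X$, i.e. $X=\mathrm{cl}(\mathrm{int}(X))$; write $i(X)$ for the interior. The eight RCC8 base relations between regions $a,b$ (jointly exhaustive and pairwise disjoint; $\subset$ denotes proper inclusion) are: $a\,\mathbf{EQ}\,b$: $a=b$; $a\,\mathbf{DC}\,b$: $a\cap b=\emptyset$; $a\,\mathbf{EC}\,b$: $a\cap b\neq\emptyset$ and $i(a)\cap i(b)=\emptyset$; $a\,\mathbf{PO}\,b$: $i(a)\cap i(b)\neq\emptyset$, $a\not\subseteq b$, $b\not\subseteq a$; $a\,\mathbf{TPP}\,b$: $a\subset b$ and $a\not\subset i(b)$; $a\,\mathbf{NTPP}\,b$: $a\subset i(b)$; and the converses $\mathbf{TPP}^{-1}$, $\mathbf{NTPP}^{-1}$ of the last two. Let $V$ be a finite set of variables. An RCC8 constraint is an expression $u\,R\,v$ with $u,v\in V$ and $R$ a nonempty set of base relations; an RCC8 network is a set of such constraints. It is atomic if for every pair of distinct variables $u,v$ it contains a constraint $u\,R\,v$ or $v\,R\,u$ with $R$ a singleton. It is a network over a set $\mathcal{R}$ of base relations if every constraint $u\,R\,v$ in it has $R\subseteq\mathcal{R}$. An $n$-dimensional solution (solution in $\mathbb{R}^n$) of a network is a map $\mathcal{S}$ from $V$ to regions of $\mathbb{R}^n$ such that for each constraint $u\,R\,v$ the base relation holding between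 $\mathcal{S}(u)$ and $\mathcal{S}(v)$ belongs to $R$. A network is consistent if it has a solution in $\mathbb{R}^n$ for some $n\geq 1$ (the regions need not be convex or connected). A solution is convex if every $\mathcal{S}(v)$ is a convex set. *)

(* Defs.v *)
From mathcomp Require Import all_boot all_order all_algebra.
From mathcomp Require Import all_classical all_reals all_analysis.

Set Implicit Arguments.
Unset Strict Implicit.
Unset Printing Implicit Defensive.

Export numFieldNormedType.Exports.

Local Open Scope classical_set_scope.
Local Open Scope ring_scope.

Inductive rcc8 : Type :=
  | EQ | DC | EC | PO | TPP | NTPP | TPPi | NTPPi.

Definition region (R : realType) (n : nat) (X : set 'rV[R]_n) : Prop :=
  X !=set0 /\ regclosed X.

(* The inclusions of [NTPP] and [NTPPi] are proper ([`<`], not [`<=`]): the whole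
   space is its own interior, and bears only [EQ] to itself. *)
Definition holds (R : realType) (n : nat) (r : rcc8) (a b : set 'rV[R]_n) :
    Prop :=
  match r with
  | EQ => a = b
  | DC => a `&` b = set0
  | EC => a `&` b !=set0 /\ a° `&` b° = set0
  | PO => [/\ a° `&` b° !=set0, ~ (a `<=` b) & ~ (b `<=` a)]
  | TPP => a `<` b /\ ~ (a `<` b°)
  | NTPP => a `<` b°
  | TPPi => b `<` a /\ ~ (b `<` a°)
  | NTPPi => b `<` a°
  end.

Record constraint (V : finType) : Type := Constraint {
  lhs : V;
  rel_of : set rcc8;
  rhs : V;
  rel_of_neq0 : rel_of !=set0
}.

Definition network (V : finType) : Type := set (constraint V).

Definition atomic (V : finType) (N : network V) : Prop :=
  forall u v : V, u <> v ->
    exists c : constraint V,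
      [/\ N c,
          (lhs c = u /\ rhs c = v) \/ (lhs c = v /\ rhs c = u) &
          exists r : rcc8, rel_of c = [set r]].

Definition network_over (V : finType) (A : set rcc8) (N : network V) : Prop :=
  forall c : constraint V, N c -> rel_of c `<=` A.

Definition satisfies (R : realType) (n : nat) (V : finType)
    (S : V -> set 'rV[R]_n) (c : constraint V) : Prop :=
  exists2 r : rcc8, rel_of c r & holds r (S (lhs c)) (S (rhs c)).

Definition solution (R : realType) (n : nat) (V : finType) (N : network V)
    (S : V -> set 'rV[R]_n) : Prop :=
  (forall v : V, region (S v)) /\
  (forall c : constraint V, N c -> satisfies S c).

Definition consistent (R : realType) (V : finType) (N : network V) : Prop :=
  exists n : nat, (1 <= n)%N /\ exists S : V -> set 'rV[R]_n, solution N S.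

Definition convex_solution (R : realType) (n : nat) (V : finType)
    (N : network V) (S : V -> set 'rV[R]_n) : Prop :=
  solution N S /\ forall v : V, convex_set (S v).

(* Main.v *)
Require Import Defs.
From mathcomp Require Import all_boot all_order all_algebra.
From mathcomp Require Import all_classical all_reals all_analysis.
From mathcomp Require Import ring lra.

Import Order.TTheory GRing.Theory Num.Theory.

(** A point [x] of R^3 encodes the quartic [X^4 + x0 X^3 + x1 X^2 + x2 X], whose
    value at a fixed [t] is affine in [x].  With distinct nodes [t u], the cells
    "[u] minimises the quartic over the nodes" are convex, and any two of them
    touch: up to an additive constant [(X - t u)^2 (X - t w)^2] is such a
    quartic, minimal at [t u] and [t w] only.  Replacing the defining inequality
    [q (t u) - q (t w) <= 0] by [<= eps u w], with [eps] symmetric and small,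
    separates the two cells when [eps u w < 0] and makes them overlap when
    [eps u w > 0], without disturbing the other pairs. *)

Local Open Scope classical_set_scope.
Local Open Scope ring_scope.

Section Cells.
Variable R : realType.
Implicit Types (x y : 'rV[R]_3) (s t a b : R).

Definition quartic t x : R :=
  t ^+ 4 + x 0 0 * t ^+ 3 + x 0 1 * t ^+ 2 + x 0 2 * t.

Lemma quartic_affine t s x y :
  quartic t (x + s *: (y - x)) = (1 - s) * quartic t x + s * quartic t y.
Proof. by rewrite /quartic !mxE; ring. Qed.

Lemma quartic_continuous t : continuous (quartic t).
Proof.
have cM i k : continuous (fun x : 'rV[R]_3 => x 0 i * k).
  move=> x; apply: continuousM; first exact: coord_continuous.
  exact: cst_continuous.
move=> x.
exact: (cvgD (cvgD (cvgD (cvg_cst (t ^+ 4)) (cM 0 (t ^+ 3) x))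
                   (cM 1 (t ^+ 2) x)) (cM 2 t x)).
Qed.

(* The coefficients of (X - a)^2 (X - b)^2, constant term dropped. *)
Definition bitangent a b : 'rV[R]_3 :=
  \row_i [:: - 2 * (a + b); a ^+ 2 + b ^+ 2 + 4 * a * b;
             - 2 * a * b * (a + b)]`_i.

Lemma quartic_bitangent a b t :
  quartic t (bitangent a b) =
  ((t - a) * (t - b)) ^+ 2 - (a * b) ^+ 2.
Proof. by rewrite /quartic /bitangent !mxE /=; ring. Qed.

Variables (V : finType) (t : V -> R) (eps : V -> V -> R).
Implicit Types u v w : V.

Definition cell u : set 'rV[R]_3 :=
  [set x | forall w, w != u ->
    quartic (t u) x - quartic (t w) x <= eps u w].

Definition strict_cell u : set 'rV[R]_3 :=
  [set x | forall w, w != u ->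
    quartic (t u) x - quartic (t w) x < eps u w].

Lemma gap_continuous u w :
  continuous (fun x => quartic (t u) x - quartic (t w) x).
Proof. by move=> x; apply: continuousB; exact: quartic_continuous. Qed.

(** Finitely many strict inequalities between continuous functions persist near [x]. *)
Lemma strict_cell_sub u : strict_cell u `<=` (cell u)°.
Proof.
move=> x xu.
have : \forall y \near x, forall w, w != u ->
    quartic (t u) y - quartic (t w) y < eps u w.
  apply: (@filter_forall _ _ (fun w y => w != u ->
    quartic (t u) y - quartic (t w) y < eps u w) (nbhs x)) => w.
  have [->|wu] := eqVneq w u; first exact: nearW.
  have O : nbhs (quartic (t u) x - quartic (t w) x) [set z | z < eps u w].
    by apply: open_nbhs_nbhs; split; [exact: open_lt | exact: xu].
  have : nbhs x [set y | quartic (t u) y - quartic (t w) y < eps u w].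
    exact: gap_continuous O.
  by apply: (@filterS _ (nbhs x)) => y.
by apply: (@filterS _ (nbhs x)) => y yu w wu; exact/ltW/yu.
Qed.

Lemma cell_closed u : closed (cell u).
Proof.
rewrite (_ : cell u = \bigcap_(w in [set w | w != u])
    ((fun x => quartic (t u) x - quartic (t w) x) @^-1` [set z | z <= eps u w])).
  apply: closed_bigI => w _; apply: closed_comp; last exact: closed_le.
  by move=> x _; exact: gap_continuous.
by apply/seteqP; split.
Qed.

Lemma cell_convex u : convex_set (cell u).
Proof.
move=> x y l /set_mem xu /set_mem yu; apply/mem_set => w wu.
(* [conv l x y] gives weight [l] to [x], so the parameter from [x] to [y] is [1 - l]. *)
have -> : (conv l x y : 'rV[R]_3) = x + (1 - l%:num) *: (y - x).
  by apply/rowP => i; rewrite /conv/= /unstable.onem !mxE; ring.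
have := xu w wu; have := yu w wu; rewrite !quartic_affine.
have l0 : 0 <= l%:num :> R by [].
have l1 : l%:num <= 1 :> R by [].
by move: (l%:num) l0 l1 => k; nra.
Qed.

(** Lets a point be pushed slightly towards a chosen centre without leaving a given
    neighbourhood. *)
Lemma near_segment (A : set 'rV[R]_3) x y : nbhs x A ->
  \forall s \near 0^'+, A (x + s *: (y - x)).
Proof.
move=> xA; have : (fun s : R => x + s *: (y - x)) @ 0^'+ --> x.
  rewrite -[X in _ --> X]addr0 -(scale0r (y - x)).
  apply: cvg_at_right_filter; apply: cvgD; first exact: cvg_cst.
  by apply: cvgZr_tmp; exact: cvg_id.
by apply.
Qed.

(** Averaging a weak inequality at [x] with a strict one at [c] gives a strict one, so points of the
    strict cell on the segment to [c] accumulate at [x]. *)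
Lemma cell_region u : strict_cell u !=set0 -> region (cell u).
Proof.
move=> [c uc]; split.
  by exists c; apply: interior_subset; exact: strict_cell_sub.
apply/seteqP; split.
  rewrite [X in _ `<=` X](closure_id _).1; last exact: cell_closed.
  by apply: closureS; exact: interior_subset.
move=> x xu B /(near_segment B x c) xB.
have [s [Bs s0 s1]] : exists s : R, [/\ B (x + s *: (c - x)), 0 < s & s < 1].
  near (0 : R)^'+ => s; exists s; split; near: s => //.
    exact: nbhs_right_gt.
  by apply: nbhs_right_lt.
exists (x + s *: (c - x)); split=> //; apply: strict_cell_sub => w wu.
rewrite !quartic_affine; have := xu w wu; have := uc w wu; nra.
Unshelve. all: by end_near. Qed.

Hypothesis t_sep : forall u v, u != v -> 1 <= (t u - t v) ^+ 2.
Hypothesis eps_sym : forall u v, eps u v = eps v u.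
Hypothesis eps_lt1 : forall u v, `|eps u v| < 1.

(** The gap is minus a product of two squares, each at least 1 by [t_sep]. The case [u = v] is
    allowed and serves the centres of the cells. *)
Lemma bitangent_gap u v w : w != u -> w != v ->
  quartic (t u) (bitangent (t u) (t v))
    - quartic (t w) (bitangent (t u) (t v)) <= - 1.
Proof.
move=> /t_sep wu /t_sep wv; rewrite !quartic_bitangent subrr mul0r.
rewrite exprMn; nra.
Qed.

Lemma bitangentC a b : bitangent a b = bitangent b a.
Proof.
apply/rowP => i; rewrite !mxE; congr (_`_i); congr [:: _; _; _]; ring.
Qed.

Lemma quartic_bitangent_eq a b :
  quartic a (bitangent a b) = quartic b (bitangent a b).
Proof. by rewrite !quartic_bitangent !subrr mulr0 mul0r. Qed.

Lemma strict_cell_center u : strict_cell u (bitangent (t u) (t u)).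
Proof.
move=> w wu; have := bitangent_gap _ _ _ wu wu; have := eps_lt1 u w.
by rewrite ltr_norml => /andP[+ _]; lra.
Qed.

(** At [w = v] the gap is 0; at any other node it is at most -1, hence below every value of
    [eps]. *)
Lemma cell_bitangent u v : 0 <= eps u v -> cell u (bitangent (t u) (t v)).
Proof.
move=> uv w wu; have [->|wv] := eqVneq w v.
  by rewrite quartic_bitangent_eq subrr.
have := bitangent_gap _ _ _ wu wv; have := eps_lt1 u w.
by rewrite ltr_norml => /andP[+ _]; lra.
Qed.

Lemma strict_cell_bitangent u v :
  0 < eps u v -> strict_cell u (bitangent (t u) (t v)).
Proof.
move=> uv w wu; have [->|wv] := eqVneq w v.
  by rewrite quartic_bitangent_eq subrr.
have := bitangent_gap _ _ _ wu wv; have := eps_lt1 u w.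
by rewrite ltr_norml => /andP[+ _]; lra.
Qed.

(** The inequalities for [(u, v)] and [(v, u)] add up to [0 <= 2 * eps u v]. *)
Lemma cell_DC u v : u != v -> eps u v < 0 -> holds DC (cell u) (cell v).
Proof.
move=> uv e0; apply/seteqP; split=> // x [xu xv].
have := xu v; rewrite eq_sym => /(_ uv); have := xv u uv.
by rewrite (eps_sym v u); lra.
Qed.

Lemma cell_EC u v : u != v -> eps u v = 0 -> holds EC (cell u) (cell v).
Proof.
move=> uv e0; split.
  exists (bitangent (t u) (t v)); split; first by apply: cell_bitangent; rewrite e0.
  by rewrite bitangentC; apply: cell_bitangent; rewrite eps_sym e0.
apply/seteqP; split=> // x [xu xv].
have xv0 := interior_subset xv u uv.
pose c := bitangent (t v) (t v).
(* Moving [x] slightly towards [c] makes the quartic smaller at [t v] than at [t u]. *)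
have [s [us s0 s1]] : exists s : R, [/\ cell u (x + s *: (c - x)), 0 < s & s < 1].
  near (0 : R)^'+ => s; exists s; split; near: s => //.
  - exact: near_segment.
  - exact: nbhs_right_gt.
  - exact: nbhs_right_lt.
have vu : v != u by rewrite eq_sym.
have := us v vu; rewrite !quartic_affine e0.
have := bitangent_gap v v u uv uv; rewrite -/c.
move: xv0; rewrite eps_sym e0; nra.
Unshelve. all: by end_near. Qed.

(** The centre of [cell u] is a witness: there the quartic at [t v] exceeds its value at [t u] by at
    least 1, more than [eps v u]. *)
Lemma cell_not_sub u v : u != v -> ~ (cell u `<=` cell v).
Proof.
move=> uv /(_ _ (interior_subset (strict_cell_sub _ _ (strict_cell_center u)))).
move=> /(_ _ uv); rewrite eq_sym in uv.
have := bitangent_gap _ _ _ uv uv; have := eps_lt1 v u.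
by rewrite ltr_norml => /andP[_ +]; lra.
Qed.

Lemma cell_PO u v : u != v -> 0 < eps u v -> holds PO (cell u) (cell v).
Proof.
move=> uv e0; split; [|exact: cell_not_sub|by apply: cell_not_sub; rewrite eq_sym].
exists (bitangent (t u) (t v)); split; apply: strict_cell_sub.
  exact: strict_cell_bitangent.
by rewrite bitangentC; apply: strict_cell_bitangent; rewrite eps_sym.
Qed.

End Cells.

Lemma region_interior (R : realType) n (X : set 'rV[R]_n) :
  region X -> X° !=set0.
Proof.
move=> [[x Xx] rX]; apply/set0P/negP => /eqP X0.
by move: Xx; rewrite -rX X0 closure0.
Qed.

(** Ensures that every constraint of the network relates two distinct variables. *)
Lemma holds_irrefl (R : realType) n (X : set 'rV[R]_n) r :
  region X -> [set EC; DC; PO] r -> ~ holds r X X.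
Proof.
move=> rX; have [x Xx] := region_interior _ _ _ rX.
case=> [[->|->]|->] /=.
- by rewrite !setIid => -[_ X0]; rewrite X0 in Xx.
- by rewrite setIid => X0; have := interior_subset Xx; rewrite X0.
- by case=> _ + _; exact.
Qed.

Lemma natr_sqdist_ge1 (R : realDomainType) (m n : nat) :
  m != n -> 1 <= (m%:R - n%:R : R) ^+ 2.
Proof.
wlog mn : m n / (m < n)%N => [hw|_].
  by case: ltngtP => // [mn|nm] _; [|rewrite -sqrrN opprB];
    apply: hw => //; rewrite neq_ltn ?mn ?nm.
have : (m.+1%:R : R) <= n%:R by rewrite ler_nat.
by rewrite -natr1; nra.
Qed.

Theorem proposition13 (R : realType) (V : finType) (N : network V) :
  consistent R N -> atomic N -> network_over [set EC; DC; PO] N ->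
  exists S : V -> set 'rV[R]_3, convex_solution N S.
Proof.
move=> [n [_ [S0 [regS0 solS0]]]] _ overN.
(* Distinct integers as nodes are at distance at least 1, as [t_sep] demands. *)
pose t (u : V) : R := (enum_rank u : nat)%:R.
(* The sign records how the regions meet in the given solution: negative if disjoint, zero if only
   boundaries touch, positive if interiors meet. The size 1/2 stays below the gap 1. *)
pose eps u v : R :=
  if S0 u `&` S0 v == set0 then - 2^-1
  else if (S0 u)° `&` (S0 v)° == set0 then 0 else 2^-1.
have t_sep u v : u != v -> 1 <= (t u - t v) ^+ 2.
  move=> uv; apply: natr_sqdist_ge1.
  by rewrite (inj_eq val_inj) (inj_eq enum_rank_inj).
have eps_sym u v : eps u v = eps v u.
  by rewrite /eps setIC [in X in if X then 0 else _]setIC.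
have eps_lt1 u v : `|eps u v| < 1.
  by rewrite /eps ltr_norml; case: ifP => _; [|case: ifP => _]; lra.
exists (cell R V t eps); split; last exact: cell_convex.
split=> [v|c Nc].
  by apply: cell_region; exists (bitangent R (t v) (t v)); exact: strict_cell_center.
have [r cr hr] := solS0 c Nc; exists r => //.
have rA := overN c Nc r cr.
have uv : lhs c != rhs c.
  by apply/eqP => e; move: hr; rewrite e; exact: holds_irrefl.
move: (lhs c) (rhs c) uv hr => u v uv.
case: rA => [[->|->]|->] hr.
- apply: cell_EC => //; case: hr => /set0P + e.
  by rewrite /eps e eqxx => /negPf ->.
- by apply: cell_DC => //; rewrite /eps hr eqxx; lra.
- apply: cell_PO => //; case: hr => -[x [xu xv]] _ _; rewrite /eps ifF ?ifF //.
  + by apply/negbTE/set0P; exists x.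
  + by apply/negbTE/set0P; exists x; split; exact: interior_subset.
Qed.
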